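(* Let $A\in\mathbb{R}^{N\times N}$ be symmetric and $B\in\{0,1\}^{N\times M}$, with $T_{or}$, $A_{\perp}$, $\Lambda^{\perp}$ and $\Omega_i$ as defined in the context. The number of independent input signals required to solve Problem 1 is lower bounded by $$\max_{i:\lambda_i\in\Lambda^{\perp}}|\Omega_i|,$$ i.e., if $D\in\mathbb{R}^{N\times W}$ satisfies $D_{\parallel}=0$ and $(A_{\perp},D_{\perp})$ is stabilizable, then the number $W$ of columns of $D$ is at least $\max_{i:\lambda_i\in\Lambda^{\perp}}|\Omega_i|$.
   Context: $\mathrm{aut}(\mathcal{G}(A,B))$ is the group of $N\times N$ permutation matrices $P$ with $PA=AP$ and $PB=B$, acting on the node set $\{1,\dots,N\}$; its orbits (clusters) $\mathcal{C}_1,\dots,\mathcal{C}_K$ partition the nodes. The group consensus subspace is $\mathcal{X}_{or}=\{x\in\mathbb{R}^N:\ x_i=x_l\ \forall i,l\in\mathcal{C}_j,\ \forall j\}$; it is $A$-invariant. $T_{or}=\begin{bmatrix} T^{\parallel} \\ T^{\perp} \end{bmatrix}\in\mathbb{R}^{N\times N}$ is an orthogonal matrix (the irreducible-representation transformation) with $T^{\parallel}\in\mathbb{R}^{K\times N}$, $T^{\parallel}_{ij}=|\mathcal{C}_i|^{-1/2}$ if $j\in\mathcal{C}_i$ and $0$ otherwise; the rows of $T^{\perp}\in\mathbb{R}^{(N-K)\times N}$ form a basis of the orthogonal complement of $\mathcal{X}_{or}$, and each row of $T^{\perp}$ has nonzero entries only at nodes of a single cluster. One has $T_{or}AT_{or}^T=\begin{bmatrix}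 A_{\parallel} & 0 \\ 0 & A_{\perp} \end{bmatrix}$. The network with additional inputs $w\in\mathbb{R}^W$ is $\dot x=Ax+Bu+Dw$ with $D\in\mathbb{R}^{N\times W}$; $D_{\parallel}=T^{\parallel}D$ and $D_{\perp}=T^{\perp}D$. Problem 1: select $D$ such that $D_{\parallel}=0$ and $(A_{\perp},D_{\perp})$ is stabilizable (usual continuous-time sense; eigenvalues with nonnegative real part count as unstable). $\Lambda^{\perp}$ is the set of eigenvalues $\lambda_i$ of $A$ with nonnegative real part that are also eigenvalues of $A_{\perp}$. For $\lambda_i\in\Lambda^{\perp}$, $\Omega_i$ is the subspace of the eigenspace of $A$ for $\lambda_i$ consisting of vectors orthogonal to $\mathcal{X}_{or}$, and $|\Omega_i|$ denotes its dimension. The maximum over an empty $\Lambda^{\perp}$ is taken to be $0$. *)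

(* Defs.v *)
From mathcomp Require Import all_boot all_order all_algebra all_fingroup.
From mathcomp Require Import all_classical all_reals.
From mathcomp Require Import complex.

Set Implicit Arguments.
Unset Strict Implicit.
Unset Printing Implicit Defensive.

Import Order.TTheory GRing.Theory Num.Theory.
Local Open Scope classical_set_scope.
Local Open Scope ring_scope.

Definition complexify (R : realType) (m n : nat) (X : 'M[R]_(m, n)) :
  'M[R[i]]_(m, n) := map_mx (real_complex R) X.

(** Linear subspaces of R^n are row spaces, with vectors written as rows.
    Over R[i], [orthocomp] is only applied to real [X], where the bilinear and
    Hermitian notions of orthogonality to [X] coincide. *)
Definition orthocomp (F : fieldType) (m n : nat) (X : 'M[F]_(m, n)) : 'M[F]_n :=
  kermx X^T.

Definition orthogonal_mx (R : realType) (m n : nat) (T : 'M[R]_(m, n)) : Prop :=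
  T *m T^T = 1%:M /\ T^T *m T = 1%:M.

Definition hurwitz (R : realType) (n : nat) (F : 'M[R]_n) : Prop :=
  forall lam : R[i], eigenvalue (complexify F) lam -> complex.Re lam < 0.

Definition stabilizable (R : realType) (n m : nat)
    (A : 'M[R]_n) (B : 'M[R]_(n, m)) : Prop :=
  exists K : 'M[R]_(m, n), hurwitz (A + B *m K).

Section Network.
Context (R : realType) (N M : nat) (A : 'M[R]_N) (B : 'M[R]_(N, M)).

Definition graph_aut : {set 'S_N} :=
  [set s : 'S_N | (perm_mx s *m A == A *m perm_mx s) && (perm_mx s *m B == B)]%SET.

Lemma graph_aut_group_set : group_set graph_aut.
Proof.
apply/group_setP; split=> [|s t].
  by rewrite inE perm_mx1 !mul1mx mulmx1 !eqxx.
rewrite !inE => /andP[/eqP sA /eqP sB] /andP[/eqP tA /eqP tB].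
by rewrite perm_mxM -!mulmxA tA tB sB mulmxA sA mulmxA !eqxx.
Qed.

Canonical graph_aut_group := Group graph_aut_group_set.

Definition clusters : {set {set 'I_N}} :=
  [set orbit 'P graph_aut x | x in [set: 'I_N]]%SET.

Definition nclusters : nat := #|clusters|.

Definition cluster (j : 'I_nclusters) : {set 'I_N} := enum_val j.

(** [kermx (delta_mx i 0 - delta_mx l 0)] is the hyperplane [x_i = x_l]. *)
Definition Xor : 'M[R]_N :=
  (\bigcap_(j < nclusters) \bigcap_(i in cluster j) \bigcap_(l in cluster j)
     kermx (delta_mx i 0 - delta_mx l 0 : 'cV[R]_N))%MS.

Lemma sub_XorP (x : 'rV[R]_N) :
  reflect (forall j i l, i \in cluster j -> l \in cluster j -> x 0 i = x 0 l)
          (x <= Xor)%MS.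
Proof.
have E i l : (x <= kermx (delta_mx i 0 - delta_mx l 0 : 'cV[R]_N))%MS
    = (x 0 i == x 0 l).
  rewrite sub_kermx mulmxBr -!colE subr_eq0.
  by apply/eqP/eqP => [/matrixP/(_ 0 0)|e]; last apply/matrixP=> a b;
    rewrite ?ord1 !mxE.
apply: (iffP sub_bigcapmxP) => [h j i l ij lj|h j _].
  apply/eqP; rewrite -E.
  by have /sub_bigcapmxP/(_ i ij)/sub_bigcapmxP/(_ l lj) := h j isT.
apply/sub_bigcapmxP => i ij; apply/sub_bigcapmxP => l lj.
by rewrite E (h j i l ij lj).
Qed.

Definition Tpar : 'M[R]_(nclusters, N) :=
  \matrix_(i, j) if j \in cluster i then (Num.sqrt #|cluster i|%:R)^-1 else 0.

(** The type of [T_or] is square up to the equation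
    [nclusters + (N - nclusters) = N]. *)
Definition Tor (Tperp : 'M[R]_(N - nclusters, N)) :
  'M[R]_(nclusters + (N - nclusters), N) := col_mx Tpar Tperp.

Record irr_transformation (Tperp : 'M[R]_(N - nclusters, N)) : Prop := {
  Tor_orthogonal : orthogonal_mx (Tor Tperp);
  Tperp_free : row_free Tperp;
  Tperp_span : (Tperp :=: orthocomp Xor)%MS;
  Tperp_single_cluster : forall r, exists c, forall j,
    Tperp r j != 0 -> j \in cluster c
}.

Section Transformed.
Variable Tperp : 'M[R]_(N - nclusters, N).

Definition Aperp : 'M[R]_(N - nclusters) :=
  drsubmx (Tor Tperp *m A *m (Tor Tperp)^T).

Definition Dpar (W : nat) (D : 'M[R]_(N, W)) := Tpar *m D.

Definition Dperp (W : nat) (D : 'M[R]_(N, W)) := Tperp *m D.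

Definition solves_problem1 (W : nat) (D : 'M[R]_(N, W)) : Prop :=
  Dpar D = 0 /\ stabilizable Aperp (Dperp D).

Definition Lambda_perp : set R[i] :=
  [set lam | [/\ eigenvalue (complexify A) lam, 0 <= complex.Re lam
               & eigenvalue (complexify Aperp) lam]].

(** The big operator over a classical set returns its default value when the
    support is infinite; this does not occur over [Lambda_perp]. *)
Lemma finite_Lambda_perp : finite_set Lambda_perp.
Proof.
pose p := char_poly (complexify A).
have [r Dp] := closed_field_poly_normal p.
apply: (@sub_finite_set _ _ [set` r]) (finite_seq r) => lam [eA _ _] /=.
move: eA; rewrite eigenvalue_root_char -/p Dp rootZ ?root_prod_XsubC //.
by rewrite lead_coef_eq0 monic_neq0 ?char_poly_monic.
Qed.

End Transformed.

(** [eigenspace] consists of left eigenvectors, whence the transpose. As [lam]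
    is complex, the subspace is taken in C^N; its dimension is that of the real
    subspace when [lam] is real. *)
Definition Omega (lam : R[i]) : 'M[R[i]]_N :=
  (eigenspace (complexify A)^T lam :&: orthocomp (complexify Xor))%MS.

End Network.

Arguments Tpar {R N M} A B.
Arguments Tor {R N M} A B Tperp.
Arguments irr_transformation {R N M} A B Tperp.
Arguments Aperp {R N M} A B Tperp.
Arguments Dpar {R N M} A B {W} D.
Arguments Dperp {R N M} A B Tperp {W} D.
Arguments solves_problem1 {R N M} A B Tperp {W} D.
Arguments Lambda_perp {R N M} A B Tperp.
Arguments finite_Lambda_perp {R N M} A B Tperp.
Arguments Omega {R N M} A B lam.
Arguments nclusters {R N M} A B.
Arguments clusters {R N M} A B.
Arguments graph_aut {R N M} A B.
Arguments Xor {R N M} A B.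

(* Main.v *)
Require Import Defs.
From mathcomp Require Import all_boot all_order all_algebra.
From mathcomp Require Import all_classical all_reals.
From mathcomp Require Import complex.

(** Stabilizability forces every unstable left eigenspace of the state matrix
    to meet the left kernel of the input matrix trivially: a left eigenvector
    [v] with [v *m B = 0] keeps its eigenvalue under every state feedback,
    since [v *m (A + B *m K) = v *m A].  Multiplication by [B] is therefore
    injective on that eigenspace, whose dimension is then at most the number of
    inputs ([stabilizable_rank_eigenspace]).

    Applied to the pair [(A_perp, D_perp)], this bounds the eigenspaces of
    [A_perp] by [W].  It remains to transport [Omega] to such an eigenspace.
    The rows of [T_perp] span the orthogonal complement of the consensus
    subspace, so each [v] in [Omega] is [w *m T_perp] for some [w]; as these
    rows are orthonormal and [A] is symmetric, [w] is a left eigenvector of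
    [A_perp = T_perp *m A *m T_perp^T] for the same eigenvalue
    ([Omega_sub_eigenspace_Aperp]).  Hence the dimension of [Omega] is at most
    that of the eigenspace of [A_perp]. *)

Import Order.TTheory GRing.Theory Num.Theory.
Local Open Scope ring_scope.

Lemma complexifyM (R : realType) (m n p : nat)
    (X : 'M[R]_(m, n)) (Y : 'M[R]_(n, p)) :
  complexify (X *m Y) = complexify X *m complexify Y.
Proof. exact: map_mxM. Qed.

Lemma complexify_tr (R : realType) (m n : nat) (X : 'M[R]_(m, n)) :
  complexify X^T = (complexify X)^T.
Proof. by rewrite /complexify map_trmx. Qed.

Lemma complexify_orthocomp (R : realType) (m n : nat) (X : 'M[R]_(m, n)) :
  complexify (orthocomp X) = orthocomp (complexify X).
Proof. by rewrite /orthocomp /complexify map_kermx map_trmx. Qed.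

(** The part of the eigenspace killed by [B] consists of eigenvectors of every
    closed loop [A + B *m K]; for an unstable eigenvalue it must vanish. *)
Lemma stabilizable_eigenspace_kermx {R : realType} {n m : nat}
    {A : 'M[R]_n} {B : 'M[R]_(n, m)} {lam : R[i]} :
  stabilizable A B -> 0 <= complex.Re lam ->
  (eigenspace (complexify A) lam :&: kermx (complexify B) = 0)%MS.
Proof.
case=> K AK_hurwitz lam_ge0; apply/eqP; apply: contraT => nz.
have /AK_hurwitz : eigenvalue (complexify (A + B *m K)) lam.
  apply: contraNneq nz => eq0; rewrite -submx0 -eq0.
  apply/eigenspaceP; rewrite /complexify map_mxD -!/(complexify _) complexifyM.
  have /eigenspaceP EA := capmxSl (eigenspace (complexify A) lam)
    (kermx (complexify B)).
  have /sub_kermxP EB := capmxSr (eigenspace (complexify A) lam)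
    (kermx (complexify B)).
  by rewrite mulmxDr EA mulmxA EB mul0mx addr0.
by rewrite ltNge lam_ge0.
Qed.

(** Multiplication by [B] embeds the eigenspace into a space of dimension [m]
    by [stabilizable_eigenspace_kermx].  The eigenvalue being unstable is
    essential: a stable eigenspace may be invisible to the inputs. *)
Lemma stabilizable_rank_eigenspace {R : realType} {n m : nat}
    {A : 'M[R]_n} {B : 'M[R]_(n, m)} {lam : R[i]} :
  stabilizable A B -> 0 <= complex.Re lam ->
  (\rank (eigenspace (complexify A) lam) <= m)%N.
Proof.
move=> stab lam_ge0.
rewrite -(mxrank_mul_ker _ (complexify B)).
by rewrite (stabilizable_eigenspace_kermx stab lam_ge0) mxrank0 addn0 rank_leq_col.
Qed.

Section Transport.
Context {R : realType} {N M : nat} {A : 'M[R]_N} {B : 'M[R]_(N, M)}.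
Context {Tperp : 'M[R]_(N - nclusters A B, N)}.

Lemma AperpE : Aperp A B Tperp = Tperp *m A *m Tperp^T.
Proof. by rewrite /Aperp /Tor mul_col_mx tr_col_mx mul_col_row block_mxKdr. Qed.

Lemma Tperp_orthonormal : irr_transformation A B Tperp -> Tperp *m Tperp^T = 1%:M.
Proof.
case=> -[TTt _] _ _ _; move: TTt.
by rewrite /Tor tr_col_mx mul_col_row scalar_mx_block => /eq_block_mx [].
Qed.

(** Kernels of real matrices keep their spanning sets under extension of
    scalars, so the real rows of [Tperp] still span the complement over the
    complex numbers, where the eigenvectors of [Aperp] live. *)
Lemma orthocomp_Xor_sub_Tperp : irr_transformation A B Tperp ->
  (orthocomp (complexify (Xor A B)) <= complexify Tperp)%MS.
Proof.
by case=> _ _ spanT _; rewrite -complexify_orthocomp /complexify map_submx spanT.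
Qed.

(** If [v = w *m Tperp] and [v *m A = lam *: v], then
    [w *m Aperp = v *m A *m Tperp^T = lam *: (w *m Tperp *m Tperp^T)
    = lam *: w].  Symmetry of [A] is what makes the right eigenvectors
    collected in [Omega] into left eigenvectors. *)
Lemma Omega_sub_eigenspace_Aperp (lam : R[i]) :
    A^T = A -> irr_transformation A B Tperp ->
  (Omega A B lam
     <= eigenspace (complexify (Aperp A B Tperp)) lam *m complexify Tperp)%MS.
Proof.
move=> A_sym T_irr.
have /eigenspaceP : (Omega A B lam <= eigenspace (complexify A)^T lam)%MS.
  exact: capmxSl.
rewrite -complexify_tr A_sym => OmegaA.
have /submxP[w Ow] : (Omega A B lam <= complexify Tperp)%MS.
  exact: submx_trans (capmxSr _ _) (orthocomp_Xor_sub_Tperp T_irr).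
rewrite Ow; apply: submxMr; apply/eigenspaceP.
rewrite AperpE !complexifyM !mulmxA -Ow OmegaA Ow -scalemxAl -mulmxA.
by rewrite -complexifyM Tperp_orthonormal // /complexify map_mx1 mulmx1.
Qed.

End Transport.

Theorem corollary3 (R : realType) (N M : nat) (A : 'M[R]_N) (B : 'M[R]_(N, M))
    (A_sym : A^T = A) (B_01 : forall i j, B i j = 0 \/ B i j = 1)
    (Tperp : 'M[R]_(N - nclusters A B, N))
    (T_irr : irr_transformation A B Tperp)
    (W : nat) (D : 'M[R]_(N, W)) (D_solves : solves_problem1 A B Tperp D) :
  (\big[maxn/0]_(lam \in Lambda_perp A B Tperp) \rank (Omega A B lam) <= W)%N.
Proof.
case: D_solves => _ stab.
rewrite (fsbig_finite _ _ (finite_Lambda_perp A B Tperp)).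
rewrite big_seq; elim/big_ind: _ => [//|m n mW nW|lam].
  by rewrite geq_max mW.
rewrite in_fset_set; last exact: finite_Lambda_perp.
rewrite inE => -[_ lam_ge0 _].
apply: leq_trans (stabilizable_rank_eigenspace stab lam_ge0).
exact: leq_trans (mxrankS (Omega_sub_eigenspace_Aperp lam A_sym T_irr))
  (mxrankM_maxl _ _).
Qed.
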